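(* Let $(\boldsymbol{w},\{\Gamma(t)\}_{0\le t\le T})$ be any (strong) solution of the three-phase Mullins--Sekerka problem $$\begin{cases}\Delta\boldsymbol{w}=\boldsymbol{0} & \text{in } \Omega\setminus\Gamma(t),\\ \boldsymbol{w}\cdot[\boldsymbol{\chi}]=\sigma\varkappa & \text{on }\Gamma(t),\\ [\nabla\boldsymbol{w}]\,\vec\nu=-V[\boldsymbol{\chi}] & \text{on }\Gamma(t),\\ \partial_{\vec\nu_\Omega}\boldsymbol{w}=\boldsymbol{0} & \text{on }\partial\Omega,\\ \sum_{i=1}^3\sigma_i\vec\mu_i=\vec 0 & \text{on }\partial\Gamma_1(t)\cap\partial\Gamma_2(t)\cap\partial\Gamma_3(t),\\ \Gamma(0)=\Gamma^0,\end{cases}$$ for times $t\in[0,T]$, where $\Omega_1(t),\Omega_2(t),\Omega_3(t)$ are the domains bounded by $\Gamma_2(t)\cup\Gamma_3(t)$, $\Gamma_1(t)\cup\Gamma_3(t)$, and $\Gamma_1(t)\cup\Gamma_2(t)\cup\partial\Omega$, respectively. Then $$\frac{\mathrm d}{\mathrm dt}|\Omega_j(t)|=0,\qquad j=1,2,3,$$ where $|\Omega_j(t)|$ denotes the area of $\Omega_j(t)$.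
   Context: Setting. $\Omega\subset\mathbb R^2$ is a bounded domain with outer unit normal $\vec\nu_\Omega$ on $\partial\Omega$. For each $t\in[0,T]$, $\Gamma(t)=\Gamma_1(t)\cup\Gamma_2(t)\cup\Gamma_3(t)\subset\Omega$ is a network of three evolving smooth open (i.e. non-closed) curves that share the same two endpoints, the triple junctions $\mathcal T_1(t),\mathcal T_2(t)$, and do not otherwise intersect. The network partitions $\Omega$ into the three phases $\Omega_1(t),\Omega_2(t),\Omega_3(t)$. Notation. $\vec\nu=\vec\nu_i$ on $\Gamma_i(t)$ is a unit normal, oriented so that $\vec\nu_1$ points from $\Omega_2$ into $\Omega_3$, $\vec\nu_2$ from $\Omega_3$ into $\Omega_1$, and $\vec\nu_3$ from $\Omega_1$ into $\Omega_2$. $V$ is the velocity of $\Gamma(t)$ in the direction $\vec\nu$. $\varkappa$ is the curvature of $\Gamma(t)$ (on the interiors of the $\Gamma_i(t)$), with sign convention $\Delta_s\vec{\mathrm{Id}}=\varkappa\vec\nu$, where $\Delta_s$ is the second arclength derivative (with outward normal a unit circle has $\varkappa=-1$). $\sigma=\sigma_i$ on $\Gamma_i(t)$, where $\sigma_i$ are constant surface tension coefficients with $\sigma_1\le\sigma_2+\sigma_3$, $\sigma_2\le\sigma_1+\sigma_3$, $\sigma_3\le\sigma_1+\sigma_2$. $\vec\mu_i$ is the outer unit co-normal of $\Gamma_i(t)$ at its endpoints. $\boldsymbol\chi=(\chi_1,\chi_2,\chi_3)^T$ with $\chi_j$ the characteristic function of $\Omega_j(t)$. The jump is $[q](\vec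 x)=\lim_{\varepsilon\searrow0}\{q(\vec x+\varepsilon\vec\nu)-q(\vec x-\varepsilon\vec\nu)\}$ for $\vec x\in\Gamma(t)$. $\boldsymbol w=(w_1,w_2,w_3)^T$ takes values in $T\Sigma=\{\boldsymbol u\in\mathbb R^3\mid\sum_{j=1}^3u_j=0\}$; $\nabla\boldsymbol w$ is the matrix with rows $\nabla w_j^T$. A strong solution is a solution for which $\boldsymbol w(t,\cdot)$ is continuous across $\Gamma(t)$ and which is sufficiently regular (in space up to $\Gamma(t)$ from each side and up to $\partial\Omega$, and in time for the curves) that the equations hold pointwise and integration by parts on each phase and the transport formula for areas are valid. *)

(* Defs.v *)
From HB Require Import structures.
From mathcomp Require Import all_boot all_order all_algebra.
From mathcomp Require Import all_classical all_reals all_analysis.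
Import Order.TTheory GRing.Theory Num.Theory.
Import numFieldNormedType.Exports.

Set Implicit Arguments.
Unset Strict Implicit.
Unset Printing Implicit Defensive.

Local Open Scope classical_set_scope.
Local Open Scope ring_scope.

(* Phases and curves are both indexed by 'I_3 = {0, 1, 2}, standing for the
   usual labels 1, 2, 3. [ordS] and [ord_pred] are the cyclic successor and
   predecessor: the normal of curve i points from phase [ordS i] into phase
   [ord_pred i], i.e. nu_1 : 2 -> 3, nu_2 : 3 -> 1, nu_3 : 1 -> 2. *)

Section Plane.
Variable R : realType.
Implicit Types (u v x nu : R * R) (f q : R * R -> R) (D : set (R * R)).

Definition dot u v : R := u.1 * v.1 + u.2 * v.2.

(* The library norm on R * R is the sup norm. *)
Definition enorm u : R := Num.sqrt (dot u u).

Definition e1 : R * R := (1, 0).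
Definition e2 : R * R := (0, 1).

Definition grad f x : R * R := ('D_e1 f x, 'D_e2 f x).

Definition laplacian f x : R := 'D_e1 ('D_e1 f) x + 'D_e2 ('D_e2 f) x.

Definition C1_on D f : Prop := forall x, D x ->
  [/\ differentiable f x,
      {for x, continuous ('D_e1 f)} & {for x, continuous ('D_e2 f)}].

Definition C2_on D f : Prop :=
  [/\ C1_on D f, C1_on D ('D_e1 f) & C1_on D ('D_e2 f)].

Definition boundary D : set (R * R) := closure D `\` interior D.

Definition planar_domain D : Prop := [/\ open D, connected D & D !=set0].

Definition area_measure := (@lebesgue_measure R \x @lebesgue_measure R)%E.

Definition area D : R := fine (area_measure D).

(* [q](x) across a curve with unit normal nu at x. *)
Definition jump (W : normedModType R) (q : R * R -> W) nu x : W :=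
  lim ((q (x + e *: nu) - q (x - e *: nu)) @[e --> 0^'+]).

(* Boundary value at x of q, taken from inside D. *)
Definition trace (W : normedModType R) D (q : R * R -> W) x : W :=
  lim (q y @[y --> within D (nbhs x)]).

Definition has_trace (W : normedModType R) D (q : R * R -> W) x : Prop :=
  cvg (q y @[y --> within D (nbhs x)]).

(* A curve is a map c : R -> R * R whose restriction to [0, 1] is the
   parametrisation; being C^1 (C^2) up to the end points of [0, 1] is
   expressed by c being C^1 (C^2) on R. *)

Definition tangent (c : R -> R * R) (p : R) : R * R :=
  (enorm (derive1 c p))^-1 *: derive1 c p.

(* d/ds is |c'|^-1 d/dp; this is the second arclength derivative of Id. *)
Definition laplace_beltrami_id (c : R -> R * R) (p : R) : R * R :=
  (enorm (derive1 c p))^-1 *: derive1 (tangent c) p.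

Definition curve_integrable (c : R -> R * R) (g : R -> R) : Prop :=
  (@lebesgue_measure R).-integrable `]0, 1[
    (fun p => (g p * enorm (derive1 c p))%:E).

Definition curve_integral (c : R -> R * R) (g : R -> R) : R :=
  \int[@lebesgue_measure R]_(p in `]0, 1[) (g p * enorm (derive1 c p)).

(* Derivative relative to [0, T], hence one-sided at t = 0 and t = T. *)
Definition has_time_derivative (T : R) (g : R -> R) (t d : R) : Prop :=
  (g s - g t) / (s - t) @[s --> within `[0, T] t^'] --> d.

End Plane.

Section MullinsSekerka.
Variable R : realType.
Implicit Types (s t p q : R) (i j k l : 'I_3) (x : R * R).

(* A bounded domain whose boundary is a finite union of C^1 regular arcs
   Y b ([0, 1]) meeting at most at their end points; nuO b p is the outer unit
   normal at Y b p. *)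
Record bounded_domain (Omega : set (R * R)) (m : nat)
    (Y nuO : 'I_m -> R -> R * R) : Prop := BoundedDomain {
  bd_domain : planar_domain Omega;
  bd_bounded : bounded_set Omega;
  bd_boundary : boundary Omega = \bigcup_b (Y b @` `[0, 1]);
  bd_derivable : forall b p, derivable (Y b) p 1;
  bd_C1 : forall b, continuous (derive1 (Y b));
  bd_regular : forall b p, p \in `[0, 1] -> derive1 (Y b) p != 0;
  bd_simple : forall b b' p q, p \in `]0, 1[ -> q \in `[0, 1] ->
    Y b p = Y b' q -> b = b' /\ p = q;
  bd_normal_unit : forall b p, p \in `]0, 1[ -> enorm (nuO b p) = 1;
  bd_normal_orth : forall b p, p \in `]0, 1[ ->
    dot (nuO b p) (derive1 (Y b) p) = 0;
  bd_normal_outer : forall b p, p \in `]0, 1[ ->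
    \forall e \near 0^'+, ~ closure Omega (Y b p + e *: nuO b p) /\
                          Omega (Y b p - e *: nuO b p)
}.

Definition curve (X : 'I_3 -> R -> R -> R * R) (i : 'I_3) (t : R) :
  set (R * R) := X i t @` `[0, 1].

Definition network_set (X : 'I_3 -> R -> R -> R * R) (t : R) : set (R * R) :=
  \bigcup_i curve X i t.

(* X i t is a parametrisation over [0, 1] of the curve Gamma_i(t); all three
   curves run from the junction at p = 0 to the junction at p = 1. nu i t p is
   the unit normal at X i t p, and Om j t is the phase Omega_j(t). Regularity
   up to the ends of [0, T] and [0, 1] is again expressed on R. *)
Record evolving_network (Omega : set (R * R)) (T : R)
    (X nu : 'I_3 -> R -> R -> R * R) (Om : 'I_3 -> R -> set (R * R)) : Prop :=
  EvolvingNetwork {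
  en_derivable_time : forall i t p, derivable (fun s => X i s p) t 1;
  en_derivable_space : forall i t p, derivable (X i t) p 1;
  en_derivable_space2 : forall i t p, derivable (derive1 (X i t)) p 1;
  en_continuous : forall i, continuous (fun z : R * R => X i z.1 z.2);
  en_C1_time : forall i,
    continuous (fun z : R * R => derive1 (fun s => X i s z.2) z.1);
  en_C1_space : forall i, continuous (fun z : R * R => derive1 (X i z.1) z.2);
  en_C2_space : forall i, continuous (fun z : R * R => derive1 (derive1 (X i z.1)) z.2);
  en_regular : forall i t p, t \in `[0, T] -> p \in `[0, 1] ->
    derive1 (X i t) p != 0;
  en_inside : forall t, t \in `[0, T] -> network_set X t `<=` Omega;
  en_embedded : forall i t p q, t \in `[0, T] ->
    p \in `[0, 1] -> q \in `[0, 1] -> X i t p = X i t q -> p = q;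
  en_junctions : forall i j t, t \in `[0, T] ->
    X i t 0 = X j t 0 /\ X i t 1 = X j t 1;
  en_disjoint : forall i j t p q, t \in `[0, T] ->
    p \in `]0, 1[ -> q \in `[0, 1] -> X i t p = X j t q -> i = j;
  en_phase_domain : forall j t, t \in `[0, T] -> planar_domain (Om j t);
  en_phase_disjoint : forall j k t, t \in `[0, T] -> j != k ->
    Om j t `&` Om k t = set0;
  en_phase_cover : forall t, t \in `[0, T] ->
    \bigcup_j Om j t = Omega `\` network_set X t;
  (* the third phase is the outer one *)
  en_phase_boundary : forall j t, t \in `[0, T] ->
    boundary (Om j t) =
      curve X (ordS j) t `|` curve X (ord_pred j) t `|`
      (if j == ord_max then boundary Omega else set0);
  en_normal_unit : forall i t p, t \in `[0, T] -> p \in `]0, 1[ ->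
    enorm (nu i t p) = 1;
  en_normal_orth : forall i t p, t \in `[0, T] -> p \in `]0, 1[ ->
    dot (nu i t p) (derive1 (X i t) p) = 0;
  en_normal_oriented : forall i t p, t \in `[0, T] -> p \in `]0, 1[ ->
    \forall e \near 0^'+, Om (ord_pred i) t (X i t p + e *: nu i t p) /\
                          Om (ordS i) t (X i t p - e *: nu i t p)
}.

Definition normal_velocity (X nu : 'I_3 -> R -> R -> R * R) (i : 'I_3)
  (t p : R) : R := dot (derive1 (fun s => X i s p) t) (nu i t p).

Definition chi (Om : 'I_3 -> R -> set (R * R)) (j : 'I_3) (t : R) :
  R * R -> R := \1_(Om j t).

(* The normal of curve i exterior to phase l is [outer_sign l i *: nu i],
   the sign being 0 when curve i is not part of the boundary of phase l. *)
Definition outer_sign (l i : 'I_3) : R :=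
  (l == ordS i)%:R - (l == ord_pred i)%:R.

(* Integration by parts on phase l for a function u at time t:
     \int_{Omega_l} (eta Delta u + grad eta . grad u)
       = \int_{boundary of Omega_l} eta d_n u
   for all C^1 test functions eta, all integrals being convergent. *)
Definition phase_integration_by_parts (m : nat) (Y nuO : 'I_m -> R -> R * R)
    (X nu : 'I_3 -> R -> R -> R * R) (Om : 'I_3 -> R -> set (R * R))
    (l : 'I_3) (t : R) (u : R * R -> R) : Prop :=
  forall eta : R * R -> R, C1_on setT eta ->
  let bulk x := eta x * laplacian u x + dot (grad eta x) (grad u x) in
  let flux i p :=
    eta (X i t p) * dot (trace (Om l t) (grad u) (X i t p)) (nu i t p) in
  let fluxO b p :=
    eta (Y b p) * dot (trace (Om l t) (grad u) (Y b p)) (nuO b p) in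
  [/\ (@area_measure R).-integrable (Om l t) (EFin \o bulk),
      forall i, i != l -> curve_integrable (X i t) (flux i),
      l = ord_max -> forall b, curve_integrable (Y b) (fluxO b) &
      \int[@area_measure R]_(x in Om l t) bulk x =
        \sum_(i | i != l) outer_sign l i * curve_integral (X i t) (flux i)
        + (if l == ord_max then \sum_b curve_integral (Y b) (fluxO b) else 0)].

(* The transport formula for the area of phase j. *)
Definition area_transport (T : R) (X nu : 'I_3 -> R -> R -> R * R)
    (Om : 'I_3 -> R -> set (R * R)) (j : 'I_3) (t : R) : Prop :=
  (forall i, i != j -> curve_integrable (X i t) (normal_velocity X nu i t)) /\
  has_time_derivative T (fun s => area (Om j s)) t
    (\sum_(i | i != j)
       outer_sign j i * curve_integral (X i t) (normal_velocity X nu i t)).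

(* w j t is the j-th component of the vector w(t, .), kappa i t p the
   curvature of Gamma_i(t) at X i t p. The traces of grad w are not required
   to exist at the triple junctions and at the corners of the boundary of
   Omega. Validity of integration by parts on each phase and of the transport
   formula for areas belongs to the notion of a strong solution. *)
Record strong_solution (Omega : set (R * R)) (m : nat)
    (Y nuO : 'I_m -> R -> R * R) (T : R) (sigma : 'I_3 -> R)
    (Gamma0 : 'I_3 -> set (R * R))
    (X nu : 'I_3 -> R -> R -> R * R) (kappa : 'I_3 -> R -> R -> R)
    (Om : 'I_3 -> R -> set (R * R)) (w : 'I_3 -> R -> R * R -> R) : Prop :=
  StrongSolution {
  ss_network : evolving_network Omega T X nu Om;
  ss_curvature : forall i t p, t \in `[0, T] -> p \in `]0, 1[ ->
    laplace_beltrami_id (X i t) p = kappa i t p *: nu i t p;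
  ss_sum0 : forall t x, t \in `[0, T] -> closure Omega x ->
    \sum_(j < 3) w j t x = 0;
  (* regularity *)
  ss_continuous : forall j t, t \in `[0, T] ->
    {within closure Omega, continuous (w j t)};
  ss_C2 : forall j t, t \in `[0, T] ->
    C2_on (Omega `\` network_set X t) (w j t);
  ss_trace : forall j l i t p, t \in `[0, T] -> p \in `]0, 1[ -> i != l ->
    has_trace (Om l t) (grad (w j t)) (X i t p);
  ss_trace_outer : forall j t b p, t \in `[0, T] -> p \in `]0, 1[ ->
    has_trace (Om ord_max t) (grad (w j t)) (Y b p);
  ss_parts : forall j l t, t \in `[0, T] ->
    phase_integration_by_parts Y nuO X nu Om l t (w j t);
  ss_transport : forall j t, t \in `[0, T] -> area_transport T X nu Om j t;
  (* equations *)
  ss_harmonic : forall j t x, t \in `[0, T] ->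
    (Omega `\` network_set X t) x -> laplacian (w j t) x = 0;
  ss_gibbs_thomson : forall i t p, t \in `[0, T] -> p \in `]0, 1[ ->
    \sum_(j < 3) w j t (X i t p) * jump (chi Om j t) (nu i t p) (X i t p)
    = sigma i * kappa i t p;
  ss_stefan : forall j i t p, t \in `[0, T] -> p \in `]0, 1[ ->
    dot (jump (grad (w j t)) (nu i t p) (X i t p)) (nu i t p)
    = - normal_velocity X nu i t p * jump (chi Om j t) (nu i t p) (X i t p);
  ss_neumann : forall j t b p, t \in `[0, T] -> p \in `]0, 1[ ->
    dot (trace (Om ord_max t) (grad (w j t)) (Y b p)) (nuO b p) = 0;
  (* the outer co-normal is - tangent at p = 0 and tangent at p = 1 *)
  ss_young0 : forall t, t \in `[0, T] ->
    \sum_(i < 3) sigma i *: (- tangent (X i t) 0) = 0;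
  ss_young1 : forall t, t \in `[0, T] ->
    \sum_(i < 3) sigma i *: tangent (X i t) 1 = 0;
  ss_initial : forall i, curve X i 0 = Gamma0 i
}.

End MullinsSekerka.

(* Main.v *)
Require Import Defs.
From mathcomp Require Import all_boot all_order all_algebra.
From mathcomp Require Import all_classical all_reals all_analysis.
Import Order.TTheory GRing.Theory Num.Theory.
Import numFieldNormedType.Exports.
Set Implicit Arguments.
Unset Strict Implicit.
Unset Printing Implicit Defensive.
Local Open Scope classical_set_scope.
Local Open Scope ring_scope.

(** The area of a phase changes at the rate at which its boundary curves sweep
    out area, and the sweeping velocity is the jump of the flux of the harmonic
    function w_j, so conservation of area is conservation of flux.

    Fix j and t. Testing the integration by parts formula on phase l with the
    constant function 1, harmonicity and the Neumann condition leave only the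
    fluxes of grad w_j through the two curves bounding that phase, which
    therefore cancel ([phase_flux_balance]). Summing over the three phases,
    every curve i is counted twice with opposite normals, once from each side,
    and the two contributions combine to minus the integral of
    [grad w_j] . nu_i over curve i. By the Stefan condition this is the integral
    of V_i [chi_j] ([flux_jump]), where [chi_j] is minus the sign of nu_i
    relative to the exterior normal of phase j ([jump_chi]). Hence the signed
    sum of the integrals of V_i over the boundary of phase j vanishes
    ([velocity_balance]), and the transport formula identifies this sum with
    the derivative of the area. *)

Lemma dotBl (R : realType) (u v x : R * R) : dot (u - v) x = dot u x - dot v x.
Proof. by rewrite /dot /= !mulrBl opprD addrACA. Qed.

Lemma dot0l (R : realType) (x : R * R) : dot 0 x = 0.
Proof. by rewrite /dot /= !mul0r addr0. Qed.

Lemma grad_cst (R : realType) (c : R) x : grad (cst c) x = 0.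
Proof. by rewrite /grad !derive_cst. Qed.

Lemma C1_on_cst (R : realType) D (c : R) : C1_on D (cst c).
Proof.
have dcst v : 'D_v (cst c : R * R -> R) = cst 0.
  by apply/funext => y; exact: derive_cst.
move=> x _; split; rewrite ?dcst; [exact: differentiable_cst|exact: cvg_cst..].
Qed.

(** Lets a limit taken along a normal be compared with a limit over the whole
    of the phase that the normal enters. *)
Lemma near_ray_within (R : realType) (D : set (R * R)) (x v : R * R) :
  (\forall e \near (0 : R)^'+, D (x + e *: v)) ->
  x + e *: v @[e --> (0 : R)^'+] --> within D (nbhs x).
Proof.
move=> Dv.
have ray : x + e *: v @[e --> (0 : R)^'+] --> x.
  apply: cvg_at_right_filter; rewrite -[X in _ --> X]addr0 -(scale0r v).
  by apply: cvgD; [exact: cvg_cst|apply: cvgZr_tmp; exact: cvg_id].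
move=> A /= /ray nA; near=> e.
by apply: (near nA e) => //; near: e.
Unshelve. all: by end_near. Qed.

(** A jump is a limit along the normal only, whereas traces are limits over a
    full one-sided neighbourhood; since the latter exist, restricting them to
    the normal does not change their value. *)
Lemma jump_trace (R : realType) (W : normedModType R) (D D' : set (R * R))
    (q : R * R -> W) (n x : R * R) :
  has_trace D q x -> has_trace D' q x ->
  (\forall e \near (0 : R)^'+, D (x + e *: n) /\ D' (x - e *: n)) ->
  jump q n x = trace D q x - trace D' q x.
Proof.
move=> qD qD' nDD'.
have qDl : q y @[y --> within D (nbhs x)] --> trace D q x := qD.
have qDl' : q y @[y --> within D' (nbhs x)] --> trace D' q x := qD'.
apply: cvg_lim => //; apply: cvgB.
- apply: cvg_comp qDl; apply: near_ray_within.
  by apply: filterS nDD' => e [].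
- have -> : (fun e : R => q (x - e *: n)) = (fun e => q (x + e *: (- n))).
    by apply/funext => e; rewrite scalerN.
  apply: cvg_comp qDl'; apply: near_ray_within.
  by apply: filterS nDD' => e []; rewrite scalerN.
Qed.

(** Near the curve chi_j is constant on each side, with value 1 on the side of
    phase j if that phase is adjacent; as nu i points out of phase [ordS i] into
    phase [ord_pred i], the jump is the opposite of the exterior sign. *)
Lemma jump_chi (R : realType) (Omega : set (R * R)) (T : R)
    (X nu : 'I_3 -> R -> R -> R * R) (Om : 'I_3 -> R -> set (R * R)) :
  evolving_network Omega T X nu Om ->
  forall j i t p, t \in `[0, T] -> p \in `]0, 1[ ->
  jump (chi Om j t) (nu i t p) (X i t p) = - outer_sign R j i.
Proof.
move=> net j i t p tT p01.
have chiE k y : Om k t y -> chi Om j t y = (j == k)%:R.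
  move=> ky; rewrite /chi indicE; case: eqVneq => [->|jk]; first by rewrite mem_set.
  rewrite memNset// => jy.
  have /seteqP[/(_ y) disj _] := en_phase_disjoint net tT jk.
  by apply: disj; split.
apply: cvg_lim => //; apply: cvg_near_cst.
apply: filterS (en_normal_oriented net i tT p01) => e [yp ys].
by rewrite (chiE _ _ yp) (chiE _ _ ys) /outer_sign opprB.
Qed.

Lemma phase_sub (R : realType) (Omega : set (R * R)) (T : R)
    (X nu : 'I_3 -> R -> R -> R * R) (Om : 'I_3 -> R -> set (R * R)) :
  evolving_network Omega T X nu Om ->
  forall l t, t \in `[0, T] -> Om l t `<=` Omega `\` network_set X t.
Proof. by move=> net l t tT x lx; rewrite -(en_phase_cover net tT); exists l. Qed.

Lemma eq_curve_integral (R : realType) (c : R -> R * R) (f g : R -> R) :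
  (forall p, p \in `]0, 1[ -> f p = g p) ->
  curve_integral c f = curve_integral c g.
Proof.
by move=> fg; apply: eq_Rintegral => p; rewrite inE /= => /fg ->.
Qed.

Lemma curve_integral0 (R : realType) (c : R -> R * R) :
  curve_integral c (cst 0) = 0.
Proof.
rewrite /curve_integral (eq_Rintegral _ (g := cst 0)) ?Rintegral_cst ?mul0r//.
by move=> p _; rewrite /= mul0r.
Qed.

Lemma curve_integralZ (R : realType) (c : R -> R * R) (k : R) (g : R -> R) :
  curve_integrable c g ->
  curve_integral c (fun p => k * g p) = k * curve_integral c g.
Proof.
move=> gi; rewrite /curve_integral -RintegralZl//.
by apply: eq_Rintegral => p _; rewrite mulrA.
Qed.

Lemma curve_integralB (R : realType) (c : R -> R * R) (f g : R -> R) :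
  curve_integrable c f -> curve_integrable c g ->
  curve_integral c (fun p => f p - g p) = curve_integral c f - curve_integral c g.
Proof.
move=> fi gi; rewrite /curve_integral -RintegralB//.
by apply: eq_Rintegral => p _; rewrite mulrBl.
Qed.

Lemma ordS_neq (i : 'I_3) : i != ordS i.
Proof. by case: i => [[|[|[|]]]]. Qed.

Lemma ord_pred_neq (i : 'I_3) : i != ord_pred i.
Proof. by case: i => [[|[|[|]]]]. Qed.

Lemma outer_sign_id (R : realType) (i : 'I_3) : outer_sign R i i = 0.
Proof.
by rewrite /outer_sign (negbTE (ordS_neq i)) (negbTE (ord_pred_neq i)) subrr.
Qed.

(** Each curve borders exactly two phases, with opposite exterior normals. *)
Lemma sum_outer_sign (R : realType) (i : 'I_3) (F : 'I_3 -> R) :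
  \sum_(l < 3) outer_sign R l i * F l = F (ordS i) - F (ord_pred i).
Proof.
under eq_bigr do rewrite mulrBl; rewrite sumrB.
by congr (_ - _); under eq_bigr do rewrite mulr_natl mulrb;
  rewrite -big_mkcond big_pred1_eq.
Qed.

Section StrongSolution.
Context {R : realType} {Omega : set (R * R)} {m : nat} {Y nuO : 'I_m -> R -> R * R}
  {T : R} {sigma : 'I_3 -> R} {Gamma0 : 'I_3 -> set (R * R)}
  {X nu : 'I_3 -> R -> R -> R * R} {kappa : 'I_3 -> R -> R -> R}
  {Om : 'I_3 -> R -> set (R * R)} {w : 'I_3 -> R -> R * R -> R}.
Context (sol : strong_solution Omega Y nuO T sigma Gamma0 X nu kappa Om w).

Definition phase_flux (j l i : 'I_3) (t p : R) : R :=
  dot (trace (Om l t) (grad (w j t)) (X i t p)) (nu i t p).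

(** Convergence of the one-sided flux integrals is part of the integration by
    parts formula; the test function 1 isolates it. *)
Lemma phase_flux_integrable j l i t : t \in `[0, T] -> i != l ->
  curve_integrable (X i t) (phase_flux j l i t).
Proof.
move=> tT il; have [_ /(_ i il) + _ _] := ss_parts sol j l tT (C1_on_cst 1).
by congr curve_integrable; apply/funext => p; rewrite mul1r.
Qed.

(** Divergence theorem for a harmonic function: testing with 1 kills the bulk
    integral, and for the outer phase the Neumann condition kills the flux
    through the boundary of Omega. *)
Lemma phase_flux_balance j l t : t \in `[0, T] ->
  \sum_(i | i != l) outer_sign R l i * curve_integral (X i t) (phase_flux j l i t)
  = 0.
Proof.
move=> tT; have [_ _ _] := ss_parts sol j l tT (C1_on_cst 1).
rewrite [X in X = _](eq_Rintegral _ (g := cst 0)); last first.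
  move=> x; rewrite inE => /(phase_sub (ss_network sol) tT) xO.
  by rewrite (ss_harmonic sol _ tT xO) grad_cst dot0l mulr0 addr0.
rewrite /Rintegral integral0_eq// => parts.
have outer0 : (if l == ord_max then \sum_b curve_integral (Y b) (fun p =>
    cst 1 (Y b p) * dot (trace (Om l t) (grad (w j t)) (Y b p)) (nuO b p))
    else 0) = 0.
  case: eqP => // ->; rewrite big1// => b _; rewrite -[RHS](curve_integral0 (Y b)).
  by apply: eq_curve_integral => p p01; rewrite (ss_neumann sol _ _ tT p01) mulr0.
rewrite outer0 addr0 in parts; rewrite [RHS]parts.
apply: eq_bigr => i _; congr (_ * _); apply: eq_curve_integral => p _.
by rewrite mul1r.
Qed.

(** The Stefan condition, with the jump of the gradient split into the fluxes
    seen from the two adjacent phases. *)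
Lemma flux_jump j i t p : t \in `[0, T] -> p \in `]0, 1[ ->
  phase_flux j (ordS i) i t p - phase_flux j (ord_pred i) i t p
  = - outer_sign R j i * normal_velocity X nu i t p.
Proof.
move=> tT p01; apply: oppr_inj.
rewrite opprB -dotBl -(jump_trace (n := nu i t p)).
- rewrite (ss_stefan sol _ _ tT p01) (jump_chi (ss_network sol))//.
  by rewrite mulNr mulrC.
- by apply: (ss_trace sol) => //; exact: ord_pred_neq.
- by apply: (ss_trace sol) => //; exact: ordS_neq.
- exact: (en_normal_oriented (ss_network sol)).
Qed.

(** Adding the flux balances of the three phases and regrouping the terms curve
    by curve turns each pair of one-sided fluxes into a normal velocity. *)
Lemma velocity_balance j t : t \in `[0, T] ->
  (forall i, i != j -> curve_integrable (X i t) (normal_velocity X nu i t)) ->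
  \sum_(i | i != j)
    outer_sign R j i * curve_integral (X i t) (normal_velocity X nu i t) = 0.
Proof.
move=> tT Vint.
(* [outer_sign l l = 0], so the sums may run over all curves and be exchanged. *)
have drop_self l (F : 'I_3 -> R) :
    \sum_(i | i != l) outer_sign R l i * F i = \sum_i outer_sign R l i * F i.
  by rewrite [RHS](bigD1 l)//= outer_sign_id mul0r add0r.
apply/eqP; rewrite (drop_self j (fun i => curve_integral (X i t) _)).
rewrite -oppr_eq0 -sumrN.
apply/eqP; transitivity (\sum_i \sum_l
    outer_sign R l i * curve_integral (X i t) (phase_flux j l i t)); last first.
  rewrite exchange_big; apply: big1 => l _.
  by rewrite -[LHS]drop_self phase_flux_balance.
apply: eq_bigr => i _.
rewrite (sum_outer_sign i (fun l => curve_integral _ (phase_flux j l i t))).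
rewrite -mulNr -curve_integralB; first last.
- by apply: phase_flux_integrable => //; exact: ord_pred_neq.
- by apply: phase_flux_integrable => //; exact: ordS_neq.
(* The velocity of curve j is not assumed integrable, so this curve, across
   which the flux does not jump, is treated apart. *)
have [->|ij] := eqVneq i j.
  rewrite outer_sign_id oppr0 mul0r -(curve_integral0 (X j t)).
  apply: eq_curve_integral => p p01.
  by rewrite flux_jump// outer_sign_id oppr0 mul0r.
rewrite -curve_integralZ; last exact: Vint.
by apply: eq_curve_integral => p p01; rewrite flux_jump.
Qed.

End StrongSolution.

Theorem proposition2p2 (R : realType)
  (Omega : set (R * R)) (m : nat) (Y nuO : 'I_m -> R -> R * R)
  (hOmega : bounded_domain Omega Y nuO)
  (T : R) (hT : 0 < T)
  (sigma : 'I_3 -> R)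
  (hsigma : forall i : 'I_3, sigma i <= sigma (ordS i) + sigma (ord_pred i))
  (Gamma0 : 'I_3 -> set (R * R))
  (X nu : 'I_3 -> R -> R -> R * R) (kappa : 'I_3 -> R -> R -> R)
  (Om : 'I_3 -> R -> set (R * R)) (w : 'I_3 -> R -> R * R -> R)
  (hw : strong_solution Omega Y nuO T sigma Gamma0 X nu kappa Om w) :
  forall (j : 'I_3) (t : R), t \in `[0, T] ->
    has_time_derivative T (fun s => area (Om j s)) t 0.
Proof.
move=> j t tT; have [Vint] := ss_transport hw j tT.
by rewrite (velocity_balance hw).
Qed.
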